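(* Any tensor field $f\in C_c^2(S^2;D_1)$ can be recovered from $\mathcal{T}f$, $\mathcal{T}^1f$ and $\mathcal{M}f$; that is, if $f,\tilde f\in C_c^2(S^2;D_1)$ satisfy $\mathcal{T}f=\mathcal{T}\tilde f$, $\mathcal{T}^1f=\mathcal{T}^1\tilde f$ and $\mathcal{M}f=\mathcal{M}\tilde f$ on $\mathbb{R}^2$, then $f=\tilde f$.
   Context: $D_1\subset\mathbb{R}^2$ is an open disc of radius $r_1>0$ centered at the origin. $C_c^2(S^2;D_1)$ is the space of symmetric $2$-tensor fields $f=(f_{ij})_{i,j=1,2}$, $f_{12}=f_{21}$, whose components are twice continuously differentiable and compactly supported in $D_1$ (extended by zero to $\mathbb{R}^2$). For symmetric $2$-tensors, $\langle f,g\rangle=f_{11}g_{11}+2f_{12}g_{12}+f_{22}g_{22}$. For vectors $a,b\in\mathbb{R}^2$, $(a\odot b)_{ij}=\frac12(a_ib_j+a_jb_i)$, $a^2=a\odot a$, and $a^\perp=(-a_2,a_1)$. For a unit vector $a$, an integer $k\ge0$ and a compactly supported function $h$, $\mathcal{X}^k_a h(x)=\int_0^\infty h(x+ta)\,t^k\,dt$ and $\mathcal{X}_a=\mathcal{X}^0_a$. Fix unit vectors $u=(u_1,u_2)$ and $v=(-u_1,u_2)$ that are linearly independent (so $u_1u_2\neq0$, i.e. $-1<u_1^2-u_2^2<1$). Define the functions on $\mathbb{R}^2$ $$\mathcal{T}f=\mathcal{X}_u\langle f,(u^\perp)^2\rangle+\mathcal{X}_v\langle f,(v^\perp)^2\rangle,\quad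 \mathcal{T}^1f=\mathcal{X}^1_u\langle f,(u^\perp)^2\rangle+\mathcal{X}^1_v\langle f,(v^\perp)^2\rangle,\quad \mathcal{M}f=\mathcal{X}_u\langle f,u\odot u^\perp\rangle+\mathcal{X}_v\langle f,v\odot v^\perp\rangle$$ (transverse, first moment transverse and mixed V-line transforms). (Their values on a sufficiently large closed disc centered at the origin determine them on all of $\mathbb{R}^2$.) *)

(* Defs.v *)
(* MathComp / MathComp-Analysis, over an arbitrary [R : realType].
   Indices 1, 2 are rendered as the elements 0, 1 of ['I_2]. *)
From HB Require Import structures.
From mathcomp Require Import all_boot all_order all_algebra.
From mathcomp Require Import all_classical all_reals all_analysis.
Set Implicit Arguments.
Unset Strict Implicit.
Unset Printing Implicit Defensive.
Import Order.TTheory GRing.Theory Num.Theory.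
Import numFieldNormedType.Exports.
Local Open Scope classical_set_scope.
Local Open Scope ring_scope.

Section Plane.
Context {R : realType}.
Local Notation R2 := 'rV[R]_2.
Implicit Types (a b x : R2) (h : R2 -> R) (f : R2 -> 'M[R]_2).

Definition vec2 (s t : R) : R2 := \row_(i < 2) [:: s; t]`_i.

Definition dot a b : R := \sum_(i < 2) a 0 i * b 0 i.

(* The norm [`|_|] that the library puts on ['rV[R]_2] is the sup norm, hence
   a separate Euclidean norm. The topology is the same. *)
Definition enorm a : R := Num.sqrt (dot a a).

Definition disc (r : R) : set R2 := [set x | enorm x < r].

Definition perp a : R2 := vec2 (- a 0 1) (a 0 0).

(* The symmetrized tensor product; in particular [symprod a a] is the tensor
   square of [a]. *)
Definition symprod a b : 'M[R]_2 :=
  \matrix_(i, j) ((a 0 i * b 0 j + a 0 j * b 0 i) / 2).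

Definition tdot (F G : 'M[R]_2) : R :=
  F 0 0 * G 0 0 + 2 * (F 0 1 * G 0 1) + F 1 1 * G 1 1.

(* [h] is C^(k+1) iff it is differentiable with partial derivatives of
   class C^k. *)
Fixpoint class_C (k : nat) h : Prop :=
  if k is k'.+1 then
    (forall x, differentiable h x) /\
    (forall i : 'I_2, class_C k' (fun x => 'D_(delta_mx 0 i) h x))
  else continuous h.

Definition supp h : set R2 := closure [set x | h x != 0].

(* The symmetric 2-tensor fields with components in C_c^2(D), seen as fields
   on the whole plane, i.e. already extended by zero outside D. *)
Definition Cc2_S2 (D : set R2) f : Prop :=
  (forall x, (f x)^T = f x) /\
  (forall i j : 'I_2,
     [/\ class_C 2 (fun x => f x i j),
         compact (supp (fun x => f x i j)) &
         supp (fun x => f x i j) `<=` D]).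

Definition Xray (k : nat) a h x : R :=
  Rintegral (@lebesgue_measure R) `[0, +oo[ (fun t : R => h (x + t *: a) * t ^+ k).

Definition transverse u v f x : R :=
  Xray 0 u (fun y => tdot (f y) (symprod (perp u) (perp u))) x +
  Xray 0 v (fun y => tdot (f y) (symprod (perp v) (perp v))) x.

Definition transverse1 u v f x : R :=
  Xray 1 u (fun y => tdot (f y) (symprod (perp u) (perp u))) x +
  Xray 1 v (fun y => tdot (f y) (symprod (perp v) (perp v))) x.

Definition mixed u v f x : R :=
  Xray 0 u (fun y => tdot (f y) (symprod u (perp u))) x +
  Xray 0 v (fun y => tdot (f y) (symprod v (perp v))) x.

End Plane.

(* Main.v *)
Require Import Defs.
From mathcomp Require Import all_boot all_order all_algebra.
From mathcomp Require Import all_classical all_reals all_analysis.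
From mathcomp Require Import ring lra.
Import Order.TTheory GRing.Theory Num.Theory.
Import numFieldNormedType.Exports.
Local Open Scope classical_set_scope.
Local Open Scope ring_scope.

(** The difference F = f - g satisfies the same three equations with zero data,
so the point is that the data vanish only for F = 0.  Put
a = <F, (u^perp)^2>, b = <F, (v^perp)^2>, A = X_u a, A1 = X^1_u a,
B = X_v b, B1 = X^1_v b.  The fundamental theorem of calculus along rays gives
D_u A = - a, D_u A1 = - A, D_v B = - b, D_v B1 = - B.  The transverse data say
B = - A and B1 = - A1, hence A1 has the same derivative - A along u and along v,
and so D_(u - v) A1 = 0.

The reflection v = (- u_1, u_2) makes u - v horizontal: moving far enough in
this direction pushes the whole ray of direction u out of the strip
|x_1| < r_1 containing the support of F ([Xray_escape]).  As A1 is constant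
along such a line, A1 = 0, then A = 0 and a = b = 0.  This step is [rigidity]:
a function with equal continuous derivatives along u and v, and with a zero on
every line of direction u - v, vanishes together with that derivative.

Now a = b = 0 forces F_12 = 0 and u_2^2 F_11 + u_1^2 F_22 = 0, so that
c = <F, u (.) u^perp> and d = <F, v (.) v^perp> are opposite.  The mixed datum
X_u c + X_v d = 0 then says that G = X_u c = - X_v d has derivative - c along
both u and v, and [rigidity] applies once more: c = 0, which gives
F_11 = F_22 and finally F = 0.

The only delicate point is the rule D_(u - v) = D_u - D_v, which needs
continuous partial derivatives: [is_derive_difference] proves it, and
[continuous_of_directional] supplies the continuity of A from that of
a and b. *)

(** * Directional derivatives in the plane *)

(** Lets one-variable calculus act on directional derivatives. *)
Lemma is_derive_line (R : realType) (H : 'rV[R]_2 -> R) (x a : 'rV[R]_2)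
    (s d : R) :
  is_derive s (1 : R) (fun t : R => H (x + t *: a)) d <->
  is_derive (x + s *: a) a H d.
Proof.
have E : (fun h : R => h^-1 *: (((fun t : R => H (x + t *: a)) \o shift s)
              (h *: (1 : R)) - H (x + s *: a))) =
         (fun h : R => h^-1 *: ((H \o shift (x + s *: a)) (h *: a)
              - H (x + s *: a))).
  apply/funext => h /=; congr (_ *: (H _ - _)).
  by rewrite [h *: 1]mulr1 scalerDl addrCA.
by split=> -[]; rewrite /derivable /derive => D1 D2; split;
  rewrite /derivable /derive; [rewrite -E|rewrite -E|rewrite E|rewrite E].
Qed.

Lemma derivative_continuous (R : realType) (p dp : R -> R) :
  (forall t, is_derive t (1 : R) p (dp t)) -> continuous p.
Proof.
move=> D t; apply/differentiable_continuous/derivable1_diffP.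
exact: ex_derive.
Qed.

Lemma mean_value_line (R : realType) (H k : 'rV[R]_2 -> R) (q a : 'rV[R]_2)
    (t : R) :
  (forall x, is_derive x a H (k x)) ->
  exists2 c : R, `|c| <= `|t| & H (q + t *: a) - H q = t * k (q + c *: a).
Proof.
move=> D; pose p (s : R) := H (q + s *: a).
have Dp s : is_derive s (1 : R) p (k (q + s *: a)) by apply/is_derive_line.
have cp : continuous p := derivative_continuous _ _ _ Dp.
have [t0|t0] := leP 0 t.
  have [|c cI E] := @MVT_segment R p (fun s => k (q + s *: a)) 0 t t0.
    exact: continuous_subspaceT.
  move: cI; rewrite in_itv /= => /andP[c0 ct].
  exists c; first by rewrite !ger0_norm.
  by move: E; rewrite /p scale0r addr0 subr0 => ->; rewrite mulrC.
have [|c cI E] := @MVT_segment R p (fun s => k (q + s *: a)) t 0 (ltW t0).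
  exact: continuous_subspaceT.
move: cI; rewrite in_itv /= => /andP[ct c0].
exists c; first by rewrite !ler0_norm ?lerN2// ltW.
rewrite -opprB; move: E; rewrite /p scale0r addr0 => ->.
by ring.
Qed.

Lemma continuous_box (R : realType) (k : 'rV[R]_2 -> R) (p u v : 'rV[R]_2)
    (e : R) :
  continuous k -> 0 < e ->
  exists2 d : R, 0 < d & forall al be : R, `|al| <= d -> `|be| <= d ->
    `|k (p + al *: u + be *: v) - k p| <= e.
Proof.
move=> ck e0; pose g (z : R * R) := k (p + z.1 *: u + z.2 *: v).
have cg : g z @[z --> ((0, 0) : R * R)] --> k p.
  have -> : k p = g (0, 0) by rewrite /g /= !scale0r !addr0.
  apply: (@continuous_comp _ _ _ (fun z : R * R => p + z.1 *: u + z.2 *: v) k);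
    last exact: ck.
  apply: cvgD; first apply: cvgD; first exact: cvg_cst.
    by apply: cvgZr_tmp; exact: cvg_fst.
  by apply: cvgZr_tmp; exact: cvg_snd.
move/cvgrPdist_le: cg => /(_ e e0).
case=> -[A B] /= [/nbhs_ballP[d1 /= d10 A1] /nbhs_ballP[d2 /= d20 B2]] AB.
exists (Num.min d1 d2 / 2); first by rewrite divr_gt0// lt_min d10.
have lt_half (d t : R) : 0 < d -> `|t| <= d / 2 -> ball (0 : R) d t.
  by move=> d0 td; rewrite /ball /= sub0r normrN; lra.
move=> al be ha hb; rewrite distrC; apply: (AB (al, be)); split => /=.
  apply/A1/lt_half => //; apply: le_trans ha _.
  by rewrite ler_pM2r// ge_min lexx.
apply/B2/lt_half => //; apply: le_trans hb _.
by rewrite ler_pM2r// ge_min lexx orbT.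
Qed.

(** By the mean value theorem the two legs of the broken line p, p + al u,
p + al u + be v contribute values of k1 and k2 at intermediate points, which
continuity compares with their values at p. *)
Lemma directional_increment (R : realType) (H k1 k2 : 'rV[R]_2 -> R)
    (p u v : 'rV[R]_2) (e : R) :
  (forall x, is_derive x u H (k1 x)) -> (forall x, is_derive x v H (k2 x)) ->
  continuous k1 -> continuous k2 -> 0 < e ->
  exists2 d : R, 0 < d & forall al be : R, `|al| <= d -> `|be| <= d ->
    `|H (p + al *: u + be *: v) - H p - (al * k1 p + be * k2 p)|
      <= e * (`|al| + `|be|).
Proof.
move=> D1 D2 c1 c2 e0.
have [d1 d10 B1] := continuous_box _ k1 p u v e c1 e0.
have [d2 d20 B2] := continuous_box _ k2 p u v e c2 e0.
exists (Num.min d1 d2); first by rewrite lt_min d10.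
move=> al be; rewrite !le_min => /andP[a1 a2] /andP[b1 b2].
have [c cal E1] := mean_value_line _ H k1 p u al D1.
have [c' cbe E2] := mean_value_line _ H k2 (p + al *: u) v be D2.
have := B1 c 0 (le_trans cal a1).
rewrite normr0 scale0r addr0 => /(_ (ltW d10)) I1.
have I2 := B2 al c' a2 (le_trans cbe b2).
have -> : H (p + al *: u + be *: v) - H p - (al * k1 p + be * k2 p) =
   al * (k1 (p + c *: u) - k1 p) + be * (k2 (p + al *: u + c' *: v) - k2 p).
  by rewrite !mulrBr -E1 -E2; ring.
apply: (le_trans (ler_normD _ _)); rewrite !normrM mulrDr.
by apply: lerD; rewrite mulrC ler_wpM2r.
Qed.

(** The increment estimate along al = h, be = - h; existence of the two partial
derivatives alone would not give it. *)
Lemma is_derive_difference (R : realType) (H k1 k2 : 'rV[R]_2 -> R)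
    (u v : 'rV[R]_2) :
  (forall x, is_derive x u H (k1 x)) -> (forall x, is_derive x v H (k2 x)) ->
  continuous k1 -> continuous k2 ->
  forall p, is_derive p (u - v) H (k1 p - k2 p).
Proof.
move=> D1 D2 c1 c2 p.
have C : h^-1 *: ((H \o shift p) (h *: (u - v)) - H p) @[h --> 0^']
    --> k1 p - k2 p.
  apply/cvgrPdist_le => e e0.
  have [d d0 B] := directional_increment _ H k1 k2 p u v (e / 2) D1 D2 c1 c2
    (divr_gt0 e0 (ltr0Sn _ 1)).
  exists d => //= h; rewrite /= sub0r normrN => hd h0.
  have := B h (- h) (ltW hd); rewrite normrN => /(_ (ltW hd)).
  have -> : p + h *: u + - h *: v = h *: (u - v) + p.
    by rewrite scalerBr scaleNr -addrA addrC.
  move=> I; rewrite distrC.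
  set Q := H (h *: (u - v) + p) in I *.
  have -> : h^-1 *: (Q - H p) - (k1 p - k2 p) =
            h^-1 * (Q - H p - (h * k1 p + - h * k2 p)).
    by rewrite /GRing.scale /=; field.
  rewrite normrM normfV mulrC ler_pdivrMr ?normr_gt0//.
  by apply: (le_trans I); lra.
split; first by apply/cvg_ex; exists (k1 p - k2 p).
exact: cvg_lim.
Qed.

(** * Coordinates in a basis of two vectors *)

Lemma ordinal2 (i : 'I_2) : i = 0 \/ i = 1.
Proof. by case: i => -[|[|//]] p; [left|right]; exact: val_inj. Qed.

Lemma mul_row_col_mx2 (R : realType) (w u v : 'rV[R]_2) :
  w *m col_mx u v = w 0 0 *: u + w 0 1 *: v.
Proof.
rewrite -[w in LHS](@hsubmxK _ 1 1 1) (@mul_row_col _ 1 1 1 2).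
rewrite [lsubmx _]mx11_scalar [rsubmx _]mx11_scalar !mul_scalar_mx.
rewrite [lsubmx _ _ _]mxE [rsubmx _ _ _]mxE.
by congr (w _ _ *: _ + w _ _ *: _); exact: val_inj.
Qed.

Lemma continuous_coordinate (R : realType) (p : 'rV[R]_2) (A : 'M[R]_2)
    (i : 'I_2) :
  continuous (fun x : 'rV[R]_2 => ((x - p) *m A) 0 i : R).
Proof.
have E (x : 'rV[R]_2) : ((x - p) *m A) 0 i =
    (x 0 0 - p 0 0) * A 0 i + (x 0 1 - p 0 1) * A 1 i.
  rewrite mxE !big_ord_recl big_ord0 addr0 !mxE.
  by congr ((_ - _) * _ + (x _ _ - p _ _) * A _ _); exact: val_inj.
rewrite (funext E) => x.
pose f j (y : 'rV[R]_2) := y 0 j - p 0 j.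
have c (j : 'I_2) : f j y @[y --> x] --> f j x.
  exact: (cvgB (@coord_continuous R 1 2 0 j x) (cvg_cst (p 0 j))).
have d (j : 'I_2) : f j y * A j i @[y --> x] --> f j x * A j i.
  exact: (@cvgMr_tmp R _ (nbhs x) _ (f j) _ (A j i) (c j)).
exact: (cvgD (d 0) (d 1)).
Qed.

(** In the coordinates (al, be) of x - p in the basis (u, v), the increment
estimate bounds H x - H p by a constant times |al| + |be|. *)
Lemma continuous_of_directional (R : realType) (H k1 k2 : 'rV[R]_2 -> R)
    (u v : 'rV[R]_2) :
  row_free (col_mx u v) ->
  (forall x, is_derive x u H (k1 x)) -> (forall x, is_derive x v H (k2 x)) ->
  continuous k1 -> continuous k2 -> continuous H.
Proof.
move=> huv D1 D2 c1 c2 p.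
pose A : 'M[R]_2 := col_mx u v.
pose co (x : 'rV[R]_2) := (x - p) *m invmx A.
have Ex x : x = p + co x 0 0 *: u + co x 0 1 *: v.
  rewrite -addrA -mul_row_col_mx2 mulmxKV -?row_free_unit//.
  by rewrite addrC subrK.
have co_cvg i : co x 0 i @[x --> p] --> (0 : R).
  have E : co p 0 i = 0 by rewrite /co subrr mul0mx mxE.
  rewrite -[X in _ --> X]E.
  have := @continuous_coordinate R p (invmx A) i p.
  by rewrite /continuous_at -/(co p) E.
have [d d0 B] := directional_increment _ H k1 k2 p u v 1 D1 D2 c1 c2 ltr01.
(* [K] sums the coefficients of |al| and |be|: the error terms contribute 2,
   and the linear terms contribute |k1 p| + |k2 p|. *)
pose K := 2 + `|k1 p| + `|k2 p|.
have K0 : 0 < K by rewrite /K -addrA ltr_pwDl// addr_ge0.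
have pF : Filter (nbhs p) := nbhs_filter p.
apply/cvgrPdist_le => e e0.
have eK : 0 < Num.min d (e / K) by rewrite lt_min d0 divr_gt0.
near=> x.
have small : forall i, `|co x 0 i| <= Num.min d (e / K).
  near: x; apply: filter_forall => j.
  move/cvgrPdist_le: (co_cvg j) => /(_ _ eK); apply: filterS => y.
  by rewrite sub0r normrN.
have /andP[a1 a2] : (`|co x 0 0| <= d) && (`|co x 0 0| <= e / K).
  by rewrite -le_min.
have /andP[b1 b2] : (`|co x 0 1| <= d) && (`|co x 0 1| <= e / K).
  by rewrite -le_min.
have := B _ _ a1 b1; rewrite -Ex mul1r => I.
rewrite distrC -[H x - H p](subrK (co x 0 0 * k1 p + co x 0 1 * k2 p)).
apply: (le_trans (ler_normD _ _)); apply: (le_trans (lerD I (ler_normD _ _))).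
rewrite !normrM.
have -> : e = e / K + e / K + (e / K * `|k1 p| + e / K * `|k2 p|).
  by rewrite /K; field; rewrite -/K; exact: lt0r_neq0.
by apply: lerD; apply: lerD => //; exact: ler_wpM2r.
Unshelve. all: by end_near.
Qed.

(** * The fundamental theorem of calculus along rays *)

Lemma local_antiderivative (R : realType) (p : R -> R) (M : R) :
  continuous p -> exists P : R -> R,
    forall t : R, - M < t -> t < M -> is_derive t (1 : R) P (p t).
Proof.
move=> cp.
exists (fun t => \int[@lebesgue_measure R]_(s in `[- M, t]) p s).
move=> t Mt tM.
have ip : (@lebesgue_measure R).-integrable `[- M, M] (EFin \o p).
  apply: continuous_compact_integrable; first exact: segment_compact.
  exact: continuous_subspaceT.
have [D E] := @continuous_FTC1_closed R p (- M) t M tM ip Mt (cp t).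
by apply: (DeriveDef D); rewrite -derive1E.
Qed.

Lemma integral_truncated (R : realType) (q Q : R -> R) (L : R) :
  0 < L -> continuous q -> (forall t, L <= t -> q t = 0) ->
  (forall t, 0 <= t -> t <= L -> is_derive t (1 : R) Q (q t)) ->
  Rintegral (@lebesgue_measure R) `[0, +oo[ q = Q L - Q 0.
Proof.
move=> L0 cq q0 DQ.
have cQ t : 0 <= t -> t <= L -> {for t, continuous Q}.
  move=> t0 tL; apply/differentiable_continuous/derivable1_diffP.
  by have [] := DQ t t0 tL.
have -> : Rintegral (@lebesgue_measure R) `[0, +oo[ q =
          Rintegral (@lebesgue_measure R) `[0, L] q.
  rewrite Rintegral_mkcond [RHS]Rintegral_mkcond; congr Rintegral.
  apply/funext => t; rewrite !patchE !mem_setE !in_itv /= andbT.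
  by have [t0|//] := leP 0 t; have [//|/ltW/q0] := leP t L.
rewrite /Rintegral (@continuous_FTC2 R q Q 0 L)//.
- exact: continuous_subspaceT.
- split.
  + move=> t; rewrite in_itv /= => /andP[t0 tL].
    by have [] := DQ t (ltW t0) (ltW tL).
  + by apply: cvg_at_right_filter; apply: cQ => //; exact: ltW.
  + by apply: cvg_at_left_filter; apply: cQ => //; exact: ltW.
- move=> t; rewrite in_itv /= => /andP[t0 tL].
  by have D := DQ t (ltW t0) (ltW tL); rewrite derive1E derive_val.
Qed.

Lemma is_derive_translate (R : realType) (P : R -> R) (s t d : R) :
  is_derive (s + t) (1 : R) P d ->
  is_derive s (1 : R) (fun r => P (r + t)) d /\
  is_derive t (1 : R) (fun r => P (s + r)) d.
Proof.
move=> D; split.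
  have := @is_derive1_comp R P (fun r => r + t) s d 1 D.
  by rewrite mulr1; apply; apply: is_derive_eq; rewrite addr0.
have Ds := is_deriveD (is_derive_cst s t (1 : R)) (is_derive_id t (1 : R)).
rewrite add0r in Ds; have := @is_derive1_comp R P (cst s + id) t d 1 D Ds.
by rewrite mulr1.
Qed.

Section Xray.
Variables (R : realType) (a : 'rV[R]_2) (h : 'rV[R]_2 -> R) (r : R).
Hypothesis a0 : a 0 0 != 0.
Hypothesis ch : continuous h.
Hypothesis hr : forall x : 'rV[R]_2, r <= `|x 0 0| -> h x = 0.

Lemma continuous_line x : continuous (fun t : R => h (x + t *: a)).
Proof.
move=> t.
apply: (@continuous_comp _ _ _ (fun s : R => x + s *: a) h); last exact: ch.
exact: (cvgD (cvg_cst x) (@cvgZr_tmp R _ _ (nbhs t) _ id t a cvg_id)).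
Qed.

(** A direction with nonzero first coordinate is transversal to the strip
|x_1| < r, so each line meets the support of h in a bounded set. *)
Lemma line_far x :
  exists2 N : R, 0 < N & forall t, N <= t -> h (x + t *: a) = 0.
Proof.
have na : 0 < `|a 0 0| by rewrite normr_gt0.
exists (1 + (`|r| + `|x 0 0|) / `|a 0 0|).
  by apply: ltr_wpDr => //; rewrite divr_ge0// addr_ge0.
move=> t ht; apply: hr; rewrite !mxE.
have : (`|r| + `|x 0 0|) / `|a 0 0| <= t by lra.
rewrite ler_pdivrMr// => I.
have t0 : 0 <= t.
  by apply: le_trans ht; rewrite addr_ge0// divr_ge0// addr_ge0.
have := lerB_normD (t * a 0 0) (x 0 0); rewrite normrM (ger0_norm t0) addrC.
by move=> J; have := ler_norm r; lra.
Qed.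

(** Here P and Q are antiderivatives, along the line, of h and of t h.  The
substitution t -> s + t in the integrals that define the transforms at x + s a
moves the dependence on s from the integrand to the endpoints and to the
factor s, so that no differentiation under the integral sign is needed.  The
fixed upper bound s + N is enough because h vanishes beyond N - 1. *)
Lemma Xray_antiderivative x : exists N (P Q : R -> R), [/\
  0 < N, h (x + N *: a) = 0,
  (forall t : R, - N - 1 < t -> t < N + 1 ->
     is_derive t (1 : R) P (h (x + t *: a)) /\
     is_derive t (1 : R) Q (t * h (x + t *: a))) &
  forall s : R, -1 < s -> s < 1 ->
     Xray 0 a h (x + s *: a) = P (s + N) - P s /\
     Xray 1 a h (x + s *: a) =
       Q (s + N) - Q s - s * (P (s + N) - P s)].
Proof.
have [N0 N00 hN0] := line_far x.
(* The margins of 1 leave room for |s| < 1 at both ends. *)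
pose N := N0 + 1; pose M := N + 1.
pose p t := h (x + t *: a); pose q t := t * p t.
have cp : continuous p := continuous_line x.
have cq : continuous q by move=> t; apply: cvgM; [exact: cvg_id|exact: cp].
have [P DP] := local_antiderivative R p M cp.
have [Q DQ] := local_antiderivative R q M cq.
exists N, P, Q; split.
- by rewrite /N; lra.
- by apply: hN0; rewrite /N; lra.
- by move=> t t1 t2; split; [apply: DP|apply: DQ]; rewrite /M; lra.
move=> s s1 s2.
have line t : h (x + s *: a + t *: a) = p (s + t).
  by rewrite /p scalerDl addrA.
have cps : continuous (fun t => p (s + t)).
  move=> t.
  apply: (@continuous_comp _ _ _ (fun r => s + r) p); last exact: cp.
  by apply: cvgD; [exact: cvg_cst|exact: cvg_id].
have N_gt0 : 0 < N by rewrite /N; lra.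
have D t : 0 <= t -> t <= N -> is_derive (s + t) (1 : R) P (p (s + t)) /\
   is_derive (s + t) (1 : R) Q (q (s + t)).
  by move=> t1 t2; split; [apply: DP|apply: DQ]; rewrite /M; lra.
split.
  apply: (etrans (integral_truncated R _ (fun t => P (s + t)) N _ _ _ _)) => //.
  - by move=> t; under eq_fun do rewrite line expr0 mulr1; exact: cps.
  - by move=> t Nt; rewrite line /p hN0 ?mul0r//; rewrite /N in Nt; lra.
  - move=> t t1 t2; rewrite line expr0 mulr1.
    by have [/is_derive_translate[]] := D t t1 t2.
  - by rewrite addr0.
apply: (etrans (integral_truncated R _ (fun t => Q (s + t) - s * P (s + t))
  N _ _ _ _)) => //.
- move=> t; under eq_fun do rewrite line expr1.
  by apply: cvgM; [exact: cps|exact: cvg_id].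
- by move=> t Nt; rewrite line /p hN0 ?mul0r//; rewrite /N in Nt; lra.
- move=> t t1 t2.
  have [/is_derive_translate[_ Ds] /is_derive_translate[_ Dq]] := D t t1 t2.
  by apply: is_derive_eq; rewrite line expr1 /q /GRing.scale /=; ring.
- by rewrite !addr0; ring.
Qed.

Lemma is_derive_Xray0 x : is_derive x a (Xray 0 a h) (- h x).
Proof.
have [N [P [Q [N0 hN D E]]]] := Xray_antiderivative x.
rewrite -[x]addr0 -[0](scale0r a); apply/is_derive_line.
apply: (@near_eq_is_derive _ _ _ (fun s => P (s + N) - P s)).
  exists 1 => //= s; rewrite /ball_ /= sub0r normrN ltr_norml => /andP[s1 s2].
  by rewrite (E s s1 s2).1.
have [||D0 _] := D 0; [lra|lra|].
have [||DN _] := D N; [lra|lra|].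
rewrite hN -[N in is_derive N _ _ _]add0r in DN.
have [{}DN _] := is_derive_translate _ _ _ _ _ DN.
by apply: is_derive_eq; rewrite scale0r addr0 sub0r.
Qed.

Lemma is_derive_Xray1 x : is_derive x a (Xray 1 a h) (- Xray 0 a h x).
Proof.
have [N [P [Q [N0 hN D E]]]] := Xray_antiderivative x.
have -> : Xray 0 a h x = P N - P 0.
  by have [||+ _] := E 0; [lra|lra|]; rewrite scale0r addr0 add0r.
rewrite -[x]addr0 -[0](scale0r a); apply/is_derive_line.
apply: (@near_eq_is_derive _ _ _
    (fun s => Q (s + N) - Q s - s * (P (s + N) - P s))).
  exists 1 => //= s; rewrite /ball_ /= sub0r normrN ltr_norml => /andP[s1 s2].
  by rewrite (E s s1 s2).2.
have [||DP0 DQ0] := D 0; [lra|lra|].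
have [||DPN DQN] := D N; [lra|lra|].
rewrite hN -[N in is_derive N _ _ _]add0r in DPN.
rewrite hN -[N in is_derive N _ _ _]add0r in DQN.
have [{}DPN _] := is_derive_translate _ _ _ _ _ DPN.
have [{}DQN _] := is_derive_translate _ _ _ _ _ DQN.
by apply: is_derive_eq; rewrite /GRing.scale /= !add0r; ring.
Qed.

Lemma Xray_far k (x : 'rV[R]_2) :
  (forall t : R, 0 <= t -> r <= `|x 0 0 + t * a 0 0|) ->
  Xray k a h x = 0.
Proof.
move=> far; rewrite /Xray /Rintegral integral0_eq// => t /=.
by rewrite in_itv /= andbT => t0; rewrite hr ?mul0r// !mxE; exact: far.
Qed.

End Xray.

(** On the bounded part of the ray that meets the supports, each integral is an
increment of an antiderivative, and antiderivatives subtract. *)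
Lemma XrayB (R : realType) (k : nat) (a : 'rV[R]_2) (h1 h2 : 'rV[R]_2 -> R)
    (r : R) (x : 'rV[R]_2) :
  a 0 0 != 0 -> continuous h1 -> continuous h2 ->
  (forall x : 'rV[R]_2, r <= `|x 0 0| -> h1 x = 0) ->
  (forall x : 'rV[R]_2, r <= `|x 0 0| -> h2 x = 0) ->
  Xray k a (fun y => h1 y - h2 y) x = Xray k a h1 x - Xray k a h2 x.
Proof.
move=> a0 c1 c2 z1 z2.
have [N1 N10 far1] := line_far _ _ _ _ a0 z1 x.
have [N2 N20 far2] := line_far _ _ _ _ a0 z2 x.
pose N := Num.max N1 N2.
have N0 : 0 < N by rewrite lt_max N10.
have cm (h : 'rV[R]_2 -> R) : continuous h ->
    continuous (fun t : R => h (x + t *: a) * t ^+ k).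
  move=> ch t; apply: cvgM; first exact: continuous_line.
  exact: exprn_continuous.
have [P1 D1] := local_antiderivative _ _ (N + 1) (cm _ c1).
have [P2 D2] := local_antiderivative _ _ (N + 1) (cm _ c2).
have far t : N <= t -> h1 (x + t *: a) = 0 /\ h2 (x + t *: a) = 0.
  by rewrite ge_max => /andP[/far1 -> /far2 ->].
have -> : Xray k a h1 x = P1 N - P1 0.
  apply: integral_truncated => //; first exact: cm.
    by move=> t /far[-> _]; rewrite mul0r.
  by move=> t t0 tN; apply: D1; lra.
have -> : Xray k a h2 x = P2 N - P2 0.
  apply: integral_truncated => //; first exact: cm.
    by move=> t /far[_ ->]; rewrite mul0r.
  by move=> t t0 tN; apply: D2; lra.
apply: (etrans (integral_truncated R _ (P1 - P2) N _ _ _ _)) => //.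
- move=> t; under eq_fun do rewrite mulrBl.
  by apply: cvgB; exact: cm.
- by move=> t /far[-> ->]; rewrite subrr mul0r.
- move=> t t0 tN; rewrite mulrBl; apply: is_deriveB; [apply: D1|apply: D2]; lra.
- by rewrite !fctE; ring.
Qed.

(** * Rigidity along the direction u - v *)

(** H is constant along u - v because its derivative there is k - k; it is
thus zero, and so is its derivative along u, which is k. *)
Lemma rigidity (R : realType) (H k : 'rV[R]_2 -> R) (u v : 'rV[R]_2) :
  (forall x, is_derive x u H (k x)) -> (forall x, is_derive x v H (k x)) ->
  continuous k ->
  (forall x, exists s : R, H (x + s *: (u - v)) = 0) ->
  forall x, H x = 0 /\ k x = 0.
Proof.
move=> Du Dv ck far.
have H0 x : H x = 0.
  have [s <-] := far x.
  pose p (t : R) := H (x + t *: (u - v)).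
  have : p 0 = p s.
    apply: is_derive_0_is_cst => t; apply/is_derive_line.
    by rewrite -(subrr (k (x + t *: (u - v)))); exact: is_derive_difference.
  by rewrite /p scale0r addr0.
move=> x; split => //.
have [_ <-] := Du x.
by rewrite (funext H0 : H = cst 0) derive_cst.
Qed.

(** As u - v is horizontal with the sign of u_1, shifting x along it moves the
starting point and the whole ray of direction u to the same side of the
strip. *)
Lemma Xray_escape (R : realType) (k : nat) (u v : 'rV[R]_2) (h : 'rV[R]_2 -> R)
    (r : R) (x : 'rV[R]_2) :
  u 0 0 != 0 -> v 0 0 = - u 0 0 ->
  (forall x : 'rV[R]_2, r <= `|x 0 0| -> h x = 0) ->
  exists s : R, Xray k u h (x + s *: (u - v)) = 0.
Proof.
move=> u0 v0 hr; have nu : 0 < `|u 0 0| by rewrite normr_gt0.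
(* The ray starts at first coordinate x_1 + 2 s u_1 and moves away from 0;
   this s makes 2 s |u_1| = |r| + |x_1|. *)
pose s := (`|r| + `|x 0 0|) / (2 * `|u 0 0|).
have s0 : 0 <= s by rewrite divr_ge0 ?addr_ge0// mulr_ge0.
exists s; apply: (Xray_far _ _ _ _ hr) => t t0; rewrite !mxE v0 opprK.
have -> : x 0 0 + s * (u 0 0 + u 0 0) + t * u 0 0 = (2 * s + t) * u 0 0 + x 0 0.
  by ring.
have st : 0 <= 2 * s + t by rewrite addr_ge0// mulr_ge0.
have := lerB_normD ((2 * s + t) * u 0 0) (x 0 0); rewrite normrM (ger0_norm st).
have : 2 * s * `|u 0 0| = `|r| + `|x 0 0|.
  by rewrite /s; field; rewrite lt0r_neq0.
move=> E I; have := ler_norm r; have := mulr_ge0 t0 (ltW nu).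
by rewrite mulrDl in I; lra.
Qed.

(** Rigidity is applied to H = X^1_u a with k = - X_u a: the derivative along v
is read off from H = - X^1_v b. *)
Lemma transverse_kernel (R : realType) (u v : 'rV[R]_2)
    (a b : 'rV[R]_2 -> R) (r : R) :
  row_free (col_mx u v) -> u 0 0 != 0 -> v 0 0 = - u 0 0 ->
  continuous a -> continuous b ->
  (forall x : 'rV[R]_2, r <= `|x 0 0| -> a x = 0) ->
  (forall x : 'rV[R]_2, r <= `|x 0 0| -> b x = 0) ->
  (forall x, Xray 0 u a x + Xray 0 v b x = 0) ->
  (forall x, Xray 1 u a x + Xray 1 v b x = 0) ->
  forall x, a x = 0 /\ b x = 0.
Proof.
move=> huv u0 v0 ca cb za zb E0 E1.
have v0' : v 0 0 != 0 by rewrite v0 oppr_eq0.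
pose A := Xray 0 u a; pose A1 := Xray 1 u a.
have EB : Xray 0 v b = - A.
  by apply/funext => x; apply/eqP; rewrite -addr_eq0 addrC E0.
have EB1 : A1 = - Xray 1 v b.
  by apply/funext => x; apply/eqP; rewrite -addr_eq0 E1.
have DuA x : is_derive x u A (- a x) := is_derive_Xray0 R u a r u0 ca za x.
have DvA x : is_derive x v A (b x).
  have -> : A = - Xray 0 v b by rewrite EB opprK.
  rewrite -[b x]opprK; apply: is_deriveN.
  exact: (is_derive_Xray0 R v b r v0' cb zb x).
have cA : continuous A.
  apply: (continuous_of_directional R A (fun x => - a x) b u v huv) => //.
  by move=> x; exact: (cvgN (ca x)).
have A0 x : A x = 0.
  suff /(_ x)[_ /eqP] : forall x, A1 x = 0 /\ - A x = 0.
    by rewrite oppr_eq0 => /eqP.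
  apply: (@rigidity R A1 (fun x => - A x) u v).
  - exact: (is_derive_Xray1 _ _ _ _ u0 ca za).
  - move=> {}x; rewrite EB1; have -> : A x = - Xray 0 v b x.
      by rewrite EB opprK.
    by apply: is_deriveN; exact: (is_derive_Xray1 _ _ _ _ v0' cb zb x).
  - by move=> {}x; exact: (cvgN (cA x)).
  - by move=> {}x; exact: (Xray_escape _ _ _ _ _ _ _ u0 v0 za).
have A00 : A = cst 0 := funext A0.
move=> x; have [_ Da] := DuA x; have [_ Db] := DvA x.
move: Da Db; rewrite A00 !derive_cst => /esym/eqP.
by rewrite oppr_eq0 => /eqP -> <-.
Qed.

(** Rigidity is applied to H = X_u c = - X_v d, whose derivative along v is
d = - c. *)
Lemma mixed_kernel (R : realType) (u v : 'rV[R]_2)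
    (c d : 'rV[R]_2 -> R) (r : R) :
  u 0 0 != 0 -> v 0 0 = - u 0 0 ->
  continuous c -> (forall x, d x = - c x) ->
  (forall x : 'rV[R]_2, r <= `|x 0 0| -> c x = 0) ->
  (forall x, Xray 0 u c x + Xray 0 v d x = 0) ->
  forall x, c x = 0.
Proof.
move=> u0 v0 cc dc zc E0 x.
have v0' : v 0 0 != 0 by rewrite v0 oppr_eq0.
have cN : continuous (fun x => - c x) by move=> y; exact: (cvgN (cc y)).
have cd : continuous d by rewrite (funext dc).
have zd (y : 'rV[R]_2) : r <= `|y 0 0| -> d y = 0.
  by move=> /zc cy; rewrite dc cy oppr0.
have EG : Xray 0 u c = - Xray 0 v d.
  by apply/funext => y; apply/eqP; rewrite -addr_eq0 E0.
suff /(_ x)[_ /eqP] : forall x, Xray 0 u c x = 0 /\ - c x = 0.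
  by rewrite oppr_eq0 => /eqP.
apply: (@rigidity R (Xray 0 u c) (fun x => - c x) u v) => //.
- exact: (is_derive_Xray0 _ _ _ _ u0 cc zc).
- move=> y; rewrite EG -dc -[d y]opprK; apply: is_deriveN.
  exact: (is_derive_Xray0 _ _ _ _ v0' cd zd y).
- by move=> y; exact: (Xray_escape _ _ _ _ _ _ _ u0 v0 zc).
Qed.

(** * Contractions of tensor fields *)

Lemma tdot_symprod (R : realType) (F : 'M[R]_2) (a b : 'rV[R]_2) :
  tdot F (symprod a b) = F 0 0 * (a 0 0 * b 0 0) +
    F 0 1 * (a 0 0 * b 0 1 + a 0 1 * b 0 0) + F 1 1 * (a 0 1 * b 0 1).
Proof. by rewrite /tdot !mxE; field. Qed.

(** The two transverse contractions differ by - 4 u_1 u_2 F_12, which kills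
F_12; then u_2^2 F_11 + u_1^2 F_22 = 0, and the two mixed contractions are
- / + u_1 u_2 (F_11 - F_22). *)
Lemma tensor_eq0 (R : realType) (u v : 'rV[R]_2) (F : 'M[R]_2) :
  F^T = F -> v = vec2 (- u 0 0) (u 0 1) -> u 0 0 != 0 -> u 0 1 != 0 ->
  tdot F (symprod (perp u) (perp u)) = 0 ->
  tdot F (symprod (perp v) (perp v)) = 0 ->
  tdot F (symprod v (perp v)) = - tdot F (symprod u (perp u)) /\
  (tdot F (symprod u (perp u)) = 0 -> F = 0).
Proof.
move=> FT -> u0 u1; rewrite !tdot_symprod !mxE /= => Ea Eb.
have F10 : F 1 0 = F 0 1 by rewrite -[in LHS]FT mxE.
have F01 : F 0 1 = 0.
  apply/eqP; have : F 0 1 * (u 0 0 * u 0 1) = 0 by lra.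
  by move/eqP; rewrite !mulf_eq0 (negPf u0) (negPf u1) !orbF.
rewrite !F01 in Ea Eb *; split; first by ring.
move=> Ec.
have F11 : F 0 0 = F 1 1.
  apply/eqP; rewrite -subr_eq0.
  have : (F 0 0 - F 1 1) * (u 0 0 * u 0 1) = 0 by lra.
  by move/eqP; rewrite !mulf_eq0 (negPf u0) (negPf u1) !orbF.
have F00 : F 0 0 = 0.
  apply/eqP; have : F 0 0 * (u 0 0 ^+ 2 + u 0 1 ^+ 2) = 0.
    by rewrite -[RHS]Ea -F11; ring.
  move/eqP; rewrite mulf_eq0 => /orP[//|].
  by rewrite paddr_eq0 ?sqr_ge0// sqrf_eq0 (negPf u0).
apply/matrixP => i j; rewrite !mxE.
by case: (ordinal2 i) => ->; case: (ordinal2 j) => ->;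
  rewrite ?F10 ?F01 ?F00 -?F11.
Qed.

Lemma normr_le_enorm (R : realType) (x : 'rV[R]_2) : `|x 0 0| <= enorm x.
Proof.
rewrite /enorm /dot !big_ord_recl big_ord0 addr0 -sqrtr_sqr ler_wsqrtr//.
by rewrite [in leLHS]expr2 lerDl -expr2 sqr_ge0.
Qed.

Lemma Cc2_S2_contract (R : realType) (r : R) (f : 'rV[R]_2 -> 'M[R]_2)
    (S : 'M[R]_2) :
  Cc2_S2 (disc r) f ->
  continuous (fun y => tdot (f y) S) /\
  (forall x : 'rV[R]_2, r <= `|x 0 0| -> tdot (f x) S = 0).
Proof.
move=> [_ Hf].
have cf i j : continuous (fun x => f x i j).
  by have [[df _] _ _] := Hf i j => x; exact: differentiable_continuous.
have zf i j (x : 'rV[R]_2) : r <= `|x 0 0| -> f x i j = 0.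
  move=> rx; apply/eqP/negPn/negP => fx.
  have sx : supp (fun y => f y i j) x by exact: subset_closure.
  have [_ _ /(_ x sx)] := Hf i j; rewrite /disc /=.
  by rewrite ltNge (le_trans rx (normr_le_enorm _ _)).
split; last by move=> x rx; rewrite /tdot !zf// !mul0r !mulr0 !addr0.
pose m i j (y : 'rV[R]_2) := f y i j * S i j.
have cm i j : continuous (m i j).
  move=> x; exact: (cvgM (cf i j x) (cvg_cst (S i j))).
have c2 : continuous (fun y => 2 * m 0 1 y).
  by move=> x; exact: (cvgM (cvg_cst (2 : R)) (cm 0 1 x)).
have c3 : continuous (fun y => m 0 0 y + 2 * m 0 1 y).
  by move=> x; exact: (cvgD (cm 0 0 x) (c2 x)).
by move=> x; exact: (cvgD (c3 x) (cm 1 1 x)).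
Qed.

(** If u_1 = 0 then v = u, and if u_2 = 0 then v = - u. *)
Lemma row_free_coord (R : realType) (u : 'rV[R]_2) :
  row_free (col_mx u (vec2 (- u 0 0) (u 0 1))) -> u 0 0 != 0 /\ u 0 1 != 0.
Proof.
set v := vec2 _ _ => free.
have kill (w : 'rV[R]_2) : w 0 0 *: u + w 0 1 *: v = 0 -> w = 0.
  rewrite -mul_row_col_mx2 => E; apply: (row_free_inj free).
  by rewrite E mul0mx.
have no (t : R) : u + t *: v <> 0.
  move=> E; have : vec2 1 t = 0 :> 'rV[R]_2.
    by apply: kill; rewrite !mxE /= scale1r.
  by move=> /rowP/(_ 0)/eqP; rewrite !mxE /= oner_eq0.
split; apply/eqP => z; [apply: (no (-1))|apply: (no 1)];
  apply/rowP => j; rewrite !mxE /=;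
  by case: (ordinal2 j) => -> /=; rewrite ?z; ring.
Qed.

(** * Injectivity of the three transforms *)

Theorem theorem10 (R : realType) (r1 : R) (hr1 : 0 < r1) (u v : 'rV[R]_2)
    (hu : enorm u = 1) (hv : v = vec2 (- u 0 0) (u 0 1))
    (huv : row_free (col_mx u v))
    (f g : 'rV[R]_2 -> 'M[R]_2)
    (hf : Cc2_S2 (disc r1) f) (hg : Cc2_S2 (disc r1) g)
    (hT : forall x : 'rV[R]_2, transverse u v f x = transverse u v g x)
    (hT1 : forall x : 'rV[R]_2, transverse1 u v f x = transverse1 u v g x)
    (hM : forall x : 'rV[R]_2, mixed u v f x = mixed u v g x) :
  f = g.
Proof.
have [u0 u1] : u 0 0 != 0 /\ u 0 1 != 0 by apply: row_free_coord; rewrite -hv.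
have v0 : v 0 0 = - u 0 0 by rewrite hv mxE.
have v0' : v 0 0 != 0 by rewrite v0 oppr_eq0.
pose F x := f x - g x.
pose con S x := tdot (f x) S - tdot (g x) S.
have conE S x : con S x = tdot (F x) S by rewrite /con /F /tdot !mxE; ring.
have ccon S : continuous (con S).
  move=> x; have [cf _] := Cc2_S2_contract _ _ _ S hf.
  by have [cg _] := Cc2_S2_contract _ _ _ S hg; exact: (cvgB (cf x) (cg x)).
have zcon S (x : 'rV[R]_2) : r1 <= `|x 0 0| -> con S x = 0.
  move=> rx; have [_ zf] := Cc2_S2_contract _ _ _ S hf.
  have [_ zg] := Cc2_S2_contract _ _ _ S hg.
  by rewrite /con zf// zg// subrr.
have XB k (a : 'rV[R]_2) S x : a 0 0 != 0 -> Xray k a (con S) x =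
    Xray k a (fun y => tdot (f y) S) x - Xray k a (fun y => tdot (g y) S) x.
  move=> a0; have [cf zf] := Cc2_S2_contract _ _ _ S hf.
  have [cg zg] := Cc2_S2_contract _ _ _ S hg.
  exact: (XrayB _ _ _ _ _ _ _ a0 cf cg zf zg).
pose a := con (symprod (perp u) (perp u)).
pose b := con (symprod (perp v) (perp v)).
pose c := con (symprod u (perp u)); pose d := con (symprod v (perp v)).
have ab0 x : a x = 0 /\ b x = 0.
  apply: (transverse_kernel R u v a b r1 huv u0 v0
    (ccon _) (ccon _) (zcon _) (zcon _)).
    move=> {}x; rewrite /a /b !XB//; have := hT x; rewrite /transverse; lra.
  move=> {}x; rewrite /a /b !XB//; have := hT1 x; rewrite /transverse1; lra.
have FT x : (F x)^T = F x.
  by rewrite /F linearB /= (proj1 hf) (proj1 hg).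
have T x : d x = - c x /\ (c x = 0 -> F x = 0).
  have [ax bx] := ab0 x; rewrite /c /d !conE.
  by apply: (tensor_eq0 R u v) => //; rewrite -conE.
have c0 x : c x = 0.
  apply: (mixed_kernel R u v c d r1 u0 v0 (ccon _) _ (zcon _)).
    by move=> y; exact: (T y).1.
  move=> {}x; rewrite /c /d !XB//; have := hM x; rewrite /mixed; lra.
apply/funext => x; apply/eqP; rewrite -subr_eq0; apply/eqP.
exact: (T x).2 (c0 x).
Qed.
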